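(* Let $S=K[x_1,\ldots,x_n]$. (1) If $I,J\subset S$ are two ideals of Borel type, then $I+J$, $I\cap J$ and $I\cdot J$ are also ideals of Borel type. (2) If $I\subset S$ is an ideal of Borel type and $J\subset S$ is an arbitrary monomial ideal, then $(I:J)$ is an ideal of Borel type.
   Context: $K$ is an infinite field, $n\geq 2$, and $S=K[x_1,\ldots,x_n]$ is the polynomial ring. A monomial ideal $I\subset S$ is of Borel type if $(I:x_j^\infty)=(I:(x_1,\ldots,x_j)^\infty)$ for all $j=1,\ldots,n$, where $(I:L^\infty)=\bigcup_{k\ge 1}(I:L^k)$ for an ideal $L$ and $(I:x_j^\infty)=(I:(x_j)^\infty)$. *)

(* Defs.v *)
From mathcomp Require Import all_boot all_order all_algebra.
From mathcomp Require Import boolp classical_sets functions cardinality.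
From mathcomp Require Import mpoly.

Set Implicit Arguments.
Unset Strict Implicit.
Unset Printing Implicit Defensive.

Import GRing.Theory.

Local Open Scope classical_set_scope.
Local Open Scope ring_scope.

Section Ideals.
Variable R : comNzRingType.
Implicit Types (I J L G : set R) (k : nat).

(* The unit ideal is allowed, unlike in the library's [idealr_closed]. *)
Definition is_ideal I : Prop :=
  [/\ I 0, forall f g, I f -> I g -> I (f + g) & forall a f, I f -> I (a * f)].

Definition ideal_gen G : set R :=
  \bigcap_(I in [set I | is_ideal I /\ G `<=` I]) I.

Definition ideal_add I J : set R := [set f + g | f in I & g in J].

Definition ideal_mul I J : set R := ideal_gen [set f * g | f in I & g in J].

Fixpoint ideal_exp L k : set R :=
  if k is k'.+1 then ideal_mul L (ideal_exp L k') else setT.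

Definition ideal_colon I J : set R := [set f | forall g, J g -> I (f * g)].

Definition ideal_sat I L : set R :=
  \bigcup_(k in [set k | (1 <= k)%N]) ideal_colon I (ideal_exp L k).

End Ideals.

Section BorelType.
Variables (K : fieldType) (n : nat).
Implicit Types (I : set {mpoly K[n]}) (j : 'I_n).

(* The generating set is arbitrary: the zero ideal (empty set of monomials)
   and the unit ideal (the monomial 1) are monomial. *)
Definition monomial_ideal I : Prop :=
  exists M : set 'X_{1..n}, I = ideal_gen [set ('X_[m] : {mpoly K[n]}) | m in M].

Definition var_ideal j : set {mpoly K[n]} := ideal_gen [set 'X_j].

(* Indices start at 0, so [x_1, ..., x_j] is [i <= j] in ['I_n]. *)
Definition initial_var_ideal j : set {mpoly K[n]} :=
  ideal_gen [set ('X_i : {mpoly K[n]}) | i in [set i : 'I_n | (i <= j)%N]].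

Definition borel_type I : Prop :=
  monomial_ideal I /\
  forall j, ideal_sat I (var_ideal j) = ideal_sat I (initial_var_ideal j).

End BorelType.

(* Main.v *)
(* A monomial ideal is determined by the up-closed set P of its monomial
   exponents, and the operations on ideals become set operations on exponents:
   sum, intersection, product and colon turn into union, intersection,
   Minkowski sum and { m | m + Q `<=` P }.  By the pigeonhole principle, f lies
   in (I : (x_1, ..., x_j)^oo) iff it lies in every (I : x_i^oo) with i <= j, so
   Borel type means that for i <= j and m + k e_j in P some m + l e_i is in P;
   each operation visibly preserves this, except that for the colon the exponent
   l has to be uniform over Q, which follows from Dickson's lemma. *)

Require Import Defs.
From mathcomp Require Import all_boot all_order all_algebra.
From mathcomp Require Import boolp classical_sets functions cardinality.
From mathcomp Require Import mpoly.

Import GRing.Theory.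

Local Open Scope classical_set_scope.
Local Open Scope ring_scope.

(** * Dickson's lemma, in terms of subsequences *)

(** Each index is chosen where [u] attains its minimum over the tail after the previous index. *)
Lemma nat_nondecreasing_subsequence (u : nat -> nat) :
  exists phi : nat -> nat, {homo phi : a b / (a < b)%N} /\
    forall a b, (a <= b)%N -> (u (phi a) <= u (phi b))%N.
Proof.
have tail_min N : exists a, (N <= a)%N /\ forall b, (N <= b)%N -> (u a <= u b)%N.
  have ex_v : exists v, `[< exists2 a, (N <= a)%N & u a = v >].
    by exists (u N); apply/asboolP; exists N.
  case: (ex_minnP ex_v) => v /asboolP[a le_Na <-] min_v.
  by exists a; split=> // b le_Nb; apply: min_v; apply/asboolP; exists b.
have [g g_min] := choice tail_min.
pose phi := fix phi a := if a is a'.+1 then g (phi a').+1 else g 0%N.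
have phi_homo : {homo phi : a b / (a < b)%N}.
  by apply: homo_ltn => [b a c|a]; [apply: ltn_trans|have [] := g_min (phi a).+1].
exists phi; split=> // a b le_ab.
have {le_ab} : (phi a <= phi b)%N by apply: (ltnW_homo phi_homo).
case: a => [|a] le_ab; first by have [_ ->] := g_min 0%N.
have [lt_phi min_phi] := g_min (phi a).+1.
by apply: min_phi; apply: leq_trans le_ab.
Qed.

Lemma dickson_subsequence n (s : nat -> 'X_{1..n}) :
  exists phi : nat -> nat, {homo phi : a b / (a < b)%N} /\
    forall a b, (a <= b)%N -> (s (phi a) <= s (phi b))%MM.
Proof.
(* Induction on a list of coordinates: a further subsequence makes the new coordinate monotone and
   keeps the earlier ones so. *)
suff [phi [phi_homo phi_s]] : exists phi : nat -> nat,
    {homo phi : a b / (a < b)%N} /\ forall i, i \in enum 'I_n ->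
      forall a b, (a <= b)%N -> (s (phi a) i <= s (phi b) i)%N.
  exists phi; split=> // a b le_ab; apply/mnm_lepP => i.
  by apply: phi_s; rewrite ?mem_enum.
elim: (enum 'I_n) => [|i r [phi [phi_homo phi_s]]]; first by exists id; split.
have [psi [psi_homo psi_s]] := nat_nondecreasing_subsequence (fun a => s (phi a) i).
exists (phi \o psi); split=> [a b lt_ab|j]; first by apply: phi_homo; apply: psi_homo.
rewrite inE => /orP[/eqP->|j_r] a b le_ab; first exact: psi_s.
by apply: phi_s => //; apply: (ltnW_homo psi_homo).
Qed.

Lemma ideal_gen_ideal (R : comNzRingType) (G : set R) : is_ideal (ideal_gen G).
Proof.
split=> [I [[]]//|f g Gf Gg I IG|a f Gf I IG].
- by case: (IG) => -[_ ID _] _; apply: ID; [apply: Gf|apply: Gg].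
- by case: (IG) => -[_ _ IM] _; apply: IM; apply: Gf.
Qed.

Lemma sub_ideal_gen (R : comNzRingType) (G : set R) : G `<=` ideal_gen G.
Proof. by move=> f Gf I [_]; apply. Qed.

Lemma ideal_gen_min (R : comNzRingType) (G I : set R) :
  is_ideal I -> G `<=` I -> ideal_gen G `<=` I.
Proof. by move=> I_ideal GI f; apply. Qed.

(** * Monomial ideals as up-closed sets of exponents *)

Section ExponentSets.
Context {K : fieldType} {n : nat}.
Implicit Types (P Q : set 'X_{1..n}) (m : 'X_{1..n}) (A : set 'I_n).
Implicit Types (I J : set {mpoly K[n]}) (f g : {mpoly K[n]}).

Definition upset P := forall m m', P m -> (m <= m')%MM -> P m'.

(** The [K]-span of the monomials with exponent in [P], given by supports so that membership is
    tested monomial by monomial. *)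
Definition exp_ideal P : set {mpoly K[n]} :=
  [set f | forall m, m \in msupp f -> P m].

Lemma exp_ideal_ideal P : upset P -> is_ideal (exp_ideal P).
Proof.
move=> upP; split=> [m|f g Pf Pg m /msuppD_le|a f Pf m /msuppM_le].
- by rewrite msupp0.
- by rewrite mem_cat => /orP[/Pf|/Pg].
- case/allpairsP=> -[m1 m2] /= [_ /Pf Pm2 ->]; apply: upP Pm2 _.
  exact: lem_addl.
Qed.

Lemma exp_idealX P m : exp_ideal P 'X_[m] <-> P m.
Proof.
split=> [|Pm m']; first by apply; rewrite msuppX inE.
by rewrite msuppX inE => /eqP->.
Qed.

(** A polynomial is the sum of its terms, so inclusion in an ideal need only be tested on
    monomials. *)
Lemma exp_ideal_sub P I :
  is_ideal I -> (forall m, P m -> I 'X_[m]) -> exp_ideal P `<=` I.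
Proof.
move=> [I0 ID IM] PI f Pf; rewrite (mpolyE f) big_seq.
apply: big_ind => // m mf; rewrite -mul_mpolyC; apply: IM.
by apply: PI; apply: Pf.
Qed.

Lemma monomial_exp_ideal P : upset P -> monomial_ideal (exp_ideal P).
Proof.
move=> upP; exists P; apply/seteqP; split.
  apply: exp_ideal_sub; first exact: ideal_gen_ideal.
  by move=> m Pm; apply: sub_ideal_gen; exists m.
apply: ideal_gen_min; first exact: exp_ideal_ideal.
by move=> _ [m Pm <-]; apply/exp_idealX.
Qed.

Lemma monomial_idealP I :
  monomial_ideal I -> exists2 P, upset P & I = exp_ideal P.
Proof.
case=> M ->; pose P := [set m | exists2 m', M m' & (m' <= m)%MM].
have upP : upset P.
  by move=> m m' [m0 Mm0 le_m0m] le_mm'; exists m0 => //; apply: lepm_trans le_mm'.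
exists P => //; apply/seteqP; split.
  apply: ideal_gen_min; first exact: exp_ideal_ideal.
  by move=> _ [m Mm <-]; apply/exp_idealX; exists m => //; apply: lepm_refl.
apply: exp_ideal_sub => [|m [m' Mm' le_m'm]]; first exact: ideal_gen_ideal.
rewrite -(submK le_m'm) mpolyXD.
have [_ _ IM] := ideal_gen_ideal {mpoly K[n]} [set 'X_[m] | m in M].
by apply: IM; apply: sub_ideal_gen; exists m'.
Qed.

(** * Ideal operations on exponents *)

Lemma mem_msuppMX f m m0 : m \in msupp f -> (m + m0)%MM \in msupp (f * 'X_[m0]).
Proof.
by move=> mf; rewrite (perm_mem (msuppMX f m0)) addmC; apply/mapP; exists m.
Qed.

(** Multiplying by a monomial shifts the support without cancellation; conversely, the support of a
    product lies in the sum of the supports. *)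
Lemma exp_ideal_colon P Q : upset P -> upset Q ->
  ideal_colon (exp_ideal P) (exp_ideal Q)
  = exp_ideal [set m | forall q, Q q -> P (m + q)%MM].
Proof.
move=> upP upQ; apply/seteqP; split=> f.
  move=> fPQ m mf q Qq; apply: (fPQ 'X_[q]); first exact/exp_idealX.
  exact: mem_msuppMX.
move=> fPQ g Qg m /msuppM_le /allpairsP[[m1 m2] /= [m1f m2g ->]].
by apply: fPQ => //; apply: Qg.
Qed.

Lemma upset_colon P Q :
  upset P -> upset [set m | forall q, Q q -> P (m + q)%MM].
Proof.
move=> upP m m' Pm le_mm' q /Pm /upP; apply; apply/mnm_lepP => i.
by rewrite !mnmDE leq_add2r; apply/mnm_lepP.
Qed.

Lemma exp_idealI P Q : exp_ideal P `&` exp_ideal Q = exp_ideal (P `&` Q).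
Proof.
apply/seteqP; split=> f; first by case=> Pf Qf m mf; split; [apply: Pf|apply: Qf].
by move=> PQf; split=> m /PQf[].
Qed.

Lemma upsetI P Q : upset P -> upset Q -> upset (P `&` Q).
Proof.
by move=> upP upQ m m' [Pm Qm] le_m; split; [apply: upP le_m|apply: upQ le_m].
Qed.

Lemma upsetU P Q : upset P -> upset Q -> upset (P `|` Q).
Proof.
by move=> upP upQ m m' [Pm|Qm] le_m; [left; apply: upP le_m|right; apply: upQ le_m].
Qed.

Lemma exp_idealD P Q : upset P -> upset Q ->
  ideal_add (exp_ideal P) (exp_ideal Q) = exp_ideal (P `|` Q).
Proof.
move=> upP upQ; have [P0 PD PM] := exp_ideal_ideal _ upP.
have [Q0 QD QM] := exp_ideal_ideal _ upQ; apply/seteqP; split.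
  move=> _ [f Pf [g Qg <-]] m /msuppD_le.
  by rewrite mem_cat => /orP[/Pf|/Qg]; [left|right].
apply: exp_ideal_sub => [|m PQm]; last first.
  case: PQm => [Pm|Qm].
    by exists 'X_[m]; [exact/exp_idealX|exists 0; rewrite ?addr0].
  by exists 0 => //; exists 'X_[m]; [exact/exp_idealX|rewrite add0r].
split; first by exists 0 => //; exists 0; rewrite ?addr0.
  move=> _ _ [f Pf [g Qg <-]] [f' Pf' [g' Qg' <-]].
  by exists (f + f'); [exact: PD|exists (g + g'); [exact: QD|rewrite addrACA]].
move=> a _ [f Pf [g Qg <-]].
by exists (a * f); [exact: PM|exists (a * g); [exact: QM|rewrite mulrDr]].
Qed.

Definition exp_add P Q : set 'X_{1..n} := [set (p + q)%MM | p in P & q in Q].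

Lemma upset_add P Q : upset P -> upset (exp_add P Q).
Proof.
move=> upP _ m [p Pp [q Qq <-]] le_m; have le_qm : (q <= m)%MM.
  by apply: lepm_trans le_m; apply: lem_addl.
(* The excess of [m] over [p + q] is absorbed into the summand from [P]. *)
exists (m - q)%MM; last by exists q => //; apply: submK.
apply: upP Pp _; apply/mnm_lepP => i; move/mnm_lepP: le_m => /(_ i).
by rewrite mnmDE mnmBE => le_m; rewrite leq_subRL ?(mnm_lepP le_qm) // addnC.
Qed.

Lemma exp_idealM P Q : upset P ->
  ideal_mul (exp_ideal P) (exp_ideal Q) = exp_ideal (exp_add P Q).
Proof.
move=> upP; apply/seteqP; split.
  apply: ideal_gen_min; first exact/exp_ideal_ideal/upset_add.
  move=> _ [f Pf [g Qg <-]] m /msuppM_le /allpairsP[[m1 m2] /= [/Pf Pm1 /Qg Qm2 ->]].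
  by exists m1 => //; exists m2.
apply: exp_ideal_sub => [|_ [p Pp [q Qq <-]]]; first exact: ideal_gen_ideal.
apply: sub_ideal_gen; exists 'X_[p]; first exact/exp_idealX.
by exists 'X_[q]; [exact/exp_idealX|rewrite mpolyXD].
Qed.

(** * Saturation by a set of variables *)

Definition exp_deg A m := (\sum_(i | `[< A i >]) m i)%N.

Lemma upset_exp_deg A k : upset [set m | (k <= exp_deg A m)%N].
Proof.
move=> m m' /= le_k /mnm_lepP le_m; apply: leq_trans le_k _.
by apply: leq_sum => i _.
Qed.

(** Covers both [var_ideal j] and [initial_var_ideal j], so that one computation of the saturation
    serves for both. *)
Let var_gen A : set {mpoly K[n]} := ideal_gen [set 'X_i | i in A].

Lemma var_gen_exp_deg A : var_gen A `<=` exp_ideal [set m | (1 <= exp_deg A m)%N].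
Proof.
apply: ideal_gen_min; first exact/exp_ideal_ideal/upset_exp_deg.
move=> _ [i Ai <-]; apply/exp_idealX.
rewrite /= /exp_deg (bigD1 i) /=; last exact/asboolP.
by rewrite mnm1E eqxx.
Qed.

Lemma var_gen_exp_sub A k :
  ideal_exp (var_gen A) k `<=` exp_ideal [set m | (k <= exp_deg A m)%N].
Proof.
elim: k => [|k IHk] //=; apply: ideal_gen_min; first exact/exp_ideal_ideal/upset_exp_deg.
move=> _ [f /var_gen_exp_deg Af [g /IHk Ag <-]] m.
move=> /msuppM_le /allpairsP[[m1 m2] /= [/Af /= A1 /Ag /= A2 ->]].
rewrite /exp_deg; under eq_bigr do rewrite mnmDE.
by rewrite big_split -add1n leq_add.
Qed.

Lemma var_gen_expX A i k : A i -> ideal_exp (var_gen A) k 'X_[U_(i) *+ k].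
Proof.
move=> Ai; elim: k => //= k IHk; rewrite mulmS mpolyXD.
apply: sub_ideal_gen; exists 'X_i; last by exists 'X_[U_(i) *+ k].
by apply: sub_ideal_gen; exists i.
Qed.

Lemma exp_ideal_sat P A f : upset P ->
  ideal_sat (exp_ideal P) (var_gen A) f <->
  forall m i, m \in msupp f -> A i -> exists k, P (m + U_(i) *+ k)%MM.
Proof.
move=> upP; split=> [[k _ fP] m i mf Ai|fP].
  exists k; apply: (fP 'X_[U_(i) *+ k]); first exact: var_gen_expX.
  exact: mem_msuppMX.
(* The exponents are chosen for all pairs at once, with value 0 outside the support of [f] or
   outside [A]. *)
have /choice[k kP] : forall mi : 'X_{1..n} * 'I_n, exists k,
    mi.1 \in msupp f -> A mi.2 -> P (mi.1 + U_(mi.2) *+ k)%MM.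
  move=> [m i] /=.
  have [[mf Ai]|nfA] := pselect (m \in msupp f /\ A i).
    by have [k Pk] := fP m i mf Ai; exists k.
  by exists 0%N => mf Ai; case: nfA.
pose N := (\max_(m <- msupp f) \max_i k (m, i))%N.
(* Pigeonhole: a degree above [n * N] in at most [n] variables forces some exponent to reach [N],
   which bounds every chosen [k]. *)
exists (n * N).+1 => // g /var_gen_exp_sub gA m.
move=> /msuppM_le /allpairsP[[m1 m2] /= [m1f /gA /= m2A ->]].
have [i Ai le_N] : exists2 i, A i & (N <= m2 i)%N.
  apply: contrapT => no_i; move: m2A; rewrite ltnNge => /negP; apply.
  apply: (@leq_trans (\sum_(i < n | `[< A i >]) N)).
    apply: leq_sum => i /asboolP Ai; rewrite leqNgt; apply/negP => lt_N.
    by apply: no_i; exists i => //; apply: ltnW.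
  rewrite sum_nat_const leq_mul2r; apply/orP; right.
  by rewrite -[leqRHS]card_ord max_card.
apply: upP (kP (m1, i) m1f Ai) _; apply/mnm_lepP => j.
rewrite !mnmDE leq_add2l mulmnE mnm1E /=.
have [<-|_] := eqVneq i j; last by [].
rewrite mul1n; apply: leq_trans le_N; apply: (@leq_trans (\max_i k (m1, i))).
  exact: (leq_bigmax (F := fun i => k (m1, i))).
exact: (leq_bigmax_seq (F := fun m => \max_i k (m, i))%N).
Qed.

(** * Borel type in terms of exponents *)

Definition borel_exp P := forall (i j : 'I_n) m k, (i <= j)%N ->
  P (m + U_(j) *+ k)%MM -> exists l, P (m + U_(i) *+ l)%MM.

(** Forward, equality of the saturations is applied to the single monomial ['X_[m]]. Backward,
    [borel_exp] is applied to each monomial of the support; the other inclusion is the case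
    [i = j]. *)
Lemma borel_type_exp P : upset P -> borel_type (exp_ideal P) <-> borel_exp P.
Proof.
move=> upP.
have var1 j : var_ideal j = var_gen [set j] by rewrite /var_gen image_set1.
split=> [[_ PB] i j m k le_ij Pm|PB].
  have : ideal_sat (exp_ideal P) (var_ideal j) 'X_[m].
    rewrite var1; apply/(exp_ideal_sat _ _ _ upP) => m' _ + ->.
    by rewrite msuppX inE => /eqP->; exists k.
  rewrite PB => /(exp_ideal_sat _ _ _ upP); apply=> //.
  by rewrite msuppX inE.
split; first exact: monomial_exp_ideal.
move=> j; rewrite var1; apply/seteqP; split=> f /(exp_ideal_sat _ _ _ upP) fP;
  apply/(exp_ideal_sat _ _ _ upP) => m i mf.
  by move=> le_ij; have [k Pk] := fP m j mf erefl; apply: PB Pk.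
by move=> ->; apply: fP => /=.
Qed.

Lemma borel_typeP I :
  borel_type I <-> exists P, [/\ upset P, borel_exp P & I = exp_ideal P].
Proof.
split=> [IB|[P [upP PB ->]]]; last exact/borel_type_exp.
have [P upP eqI] := monomial_idealP _ (proj1 IB).
by exists P; split=> //; apply/borel_type_exp; rewrite -?eqI.
Qed.

(** * Stability of the exponent condition *)

Lemma lem_addU m i k l : (k <= l)%N -> (m + U_(i) *+ k <= m + U_(i) *+ l)%MM.
Proof.
move=> le_kl; apply/mnm_lepP => j.
by rewrite !mnmDE leq_add2l !mulmnE leq_mul2l le_kl orbT.
Qed.

Lemma borel_expI P Q : upset P -> upset Q ->
  borel_exp P -> borel_exp Q -> borel_exp (P `&` Q).
Proof.
move=> upP upQ PB QB i j m k le_ij.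
move=> [/(PB _ _ _ _ le_ij)[l Pl] /(QB _ _ _ _ le_ij)[l' Ql']].
exists (maxn l l'); split; [apply: upP Pl _|apply: upQ Ql' _]; apply: lem_addU.
- exact: leq_maxl.
- exact: leq_maxr.
Qed.

Lemma borel_expU P Q : borel_exp P -> borel_exp Q -> borel_exp (P `|` Q).
Proof.
by move=> PB QB i j m k le_ij [/(PB _ _ _ _ le_ij)|/(QB _ _ _ _ le_ij)] [l];
  exists l; [left|right].
Qed.

Lemma borel_exp_add P Q : borel_exp P -> borel_exp Q -> borel_exp (exp_add P Q).
Proof.
move=> PB QB i j m k le_ij [p Pp [q Qq eq_pq]].
(* Distribute the factor x_j^k over x^p and x^q, giving p as much as it holds. *)
pose a := minn (p j) k; pose b := (k - a)%N.
have le_ap : (U_(j) *+ a <= p)%MM.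
  apply/mnm_lepP => h; rewrite mulmnE mnm1E.
  by have [<-|] := eqVneq j h; rewrite ?mul1n ?geq_minl.
(* Since [p + q] has degree at least [k] in x_j, what [p] cannot hold fits into [q]. *)
have le_bq : (U_(j) *+ b <= q)%MM.
  apply/mnm_lepP => h; rewrite mulmnE mnm1E.
  have [<-|//] := eqVneq j h; rewrite mul1n /b leq_subLR /a.
  have := congr1 (fun m : 'X_{1..n} => m j) eq_pq.
  rewrite !mnmDE mulmnE mnm1E eqxx mul1n => eqj.
  case: (leqP (p j) k) => _; first by rewrite eqj leq_addl.
  exact: leq_addr.
have eq_m : m = ((p - U_(j) *+ a) + (q - U_(j) *+ b))%MM.
  apply: (@addIm _ (U_(j) *+ k)%MM).
  rewrite -eq_pq -{1}(submK le_ap) -{1}(submK le_bq) Monoid.mulmACA /=.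
  congr (_ + _)%MM; apply/mnmP => h.
  by rewrite mnmDE !mulmnE -mulnDr /b subnKC ?geq_minr.
move: Pp Qq; rewrite -{1}(submK le_ap) -{1}(submK le_bq).
move=> /(PB _ _ _ _ le_ij)[l Pl] /(QB _ _ _ _ le_ij)[l' Ql'].
(* The powers of x_j in the two factors have been traded for powers of x_i separately, and their
   exponents add up. *)
exists (l + l')%N; exists (p - U_(j) *+ a + U_(i) *+ l)%MM => //.
exists (q - U_(j) *+ b + U_(i) *+ l')%MM => //.
rewrite eq_m Monoid.mulmACA /=; congr (_ + _)%MM; apply/mnmP => h.
by rewrite mnmDE !mulmnE mulnDr.
Qed.

Lemma borel_exp_colon P Q : upset P -> borel_exp P ->
  borel_exp [set m | forall q, Q q -> P (m + q)%MM].
Proof.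
move=> upP PB i j m k le_ij PQm; apply: contrapT => no_l.
(* A sequence of exponents q_l in Q refuting every uniform bound l would,
   by Dickson's lemma, eventually dominate one of its own terms. *)
have /choice[s sP] : forall l, exists q, Q q /\ ~ P (m + U_(i) *+ l + q)%MM.
  move=> l; apply: contrapT => no_q; apply: no_l; exists l => q Qq.
  by apply: contrapT => nPq; apply: no_q; exists q.
have [phi [phi_homo phi_s]] := dickson_subsequence _ s.
have Qs l : Q (s l) by have [] := sP l.
(* An [l] that works for the first term [s (phi 0)] also works for the larger [s (phi l)]; as
   [l <= phi l], this contradicts the choice of [s (phi l)]. *)
have /(PB _ _ _ _ le_ij)[l Pl] : P (m + s (phi 0%N) + U_(j) *+ k)%MM.
  by rewrite Monoid.mulmAC; apply: PQm.
have le_phi : (l <= phi l)%N.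
  by elim: (l) => // h IHh; apply: leq_ltn_trans IHh (phi_homo _ _ _).
have [_] := sP (phi l); apply; apply: upP Pl _; rewrite Monoid.mulmAC.
apply/mnm_lepP => h; rewrite [leqLHS]mnmDE [leqRHS]mnmDE.
by apply: leq_add; apply/mnm_lepP; [apply: lem_addU|apply: phi_s].
Qed.

End ExponentSets.

Theorem proposition1p1 (K : fieldType) (K_infinite : infinite_set [set: K])
    (n : nat) (n_ge2 : (2 <= n)%N) :
  (forall I J : set {mpoly K[n]}, borel_type I -> borel_type J ->
     [/\ borel_type (ideal_add I J), borel_type (I `&` J)
       & borel_type (ideal_mul I J)]) /\
  (forall I J : set {mpoly K[n]}, borel_type I -> monomial_ideal J ->
     borel_type (ideal_colon I J)).
Proof.
split=> I J /borel_typeP[P [upP PB ->]].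
  move=> /borel_typeP[Q [upQ QB ->]]; rewrite exp_idealD // exp_idealI exp_idealM //.
  split; apply/borel_typeP.
  - by exists (P `|` Q); split=> //; [apply: upsetU|apply: borel_expU].
  - by exists (P `&` Q); split=> //; [apply: upsetI|apply: borel_expI].
  - by exists (exp_add P Q); split=> //; [apply: upset_add|apply: borel_exp_add].
move=> /monomial_idealP[Q upQ ->]; rewrite exp_ideal_colon //; apply/borel_typeP.
exists [set m | forall q, Q q -> P (m + q)%MM]; split=> //.
- exact: upset_colon.
- exact: borel_exp_colon.
Qed.
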